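(* Let $T,U\in\mathcal{GB}^+(H)$ and suppose $S_{gF}T=TS_{gF}$, where $S_{gF}$ is the continuous $g$-fusion frame operator defined by $$\langle S_{gF}f,f\rangle=\int_X v^2(x)\,\langle P_{F(x)}\Lambda_x^*\Lambda_xP_{F(x)}f,\,f\rangle\,d\mu_x,\qquad f\in H.$$ Then $\Lambda_{TU}=\{(F(x),\Lambda_x,v(x))\}_{x\in X}$ is a continuous $(T,U)$-controlled $g$-fusion frame for $H$ if and only if it is a continuous $g$-fusion frame for $H$.
   Context: $H$ is a separable Hilbert space with identity operator $I_H$, $\mathbb H$ is the collection of all closed subspaces of $H$, and $(X,\mu)$ is a measure space with positive measure $\mu$; $d\mu_x$ denotes integration with respect to $\mu$ in the variable $x$. $P_M$ is the orthogonal projection of $H$ onto a closed subspace $M$ (when followed by an operator defined on $M$ it is regarded as a map $H\to M$; its adjoint is then the inclusion $M\to H$). An operator is positive if it is self-adjoint and $\langle Sf,f\rangle\ge 0$ for all $f$; $\mathcal{GB}^+(H)$ is the set of positive bounded operators on $H$ with bounded inverse. Throughout, $F:X\to\mathbb H$ is a mapping, $v:X\to\mathbb R^+$ is measurable, $\{K_x\}_{x\in X}$ are Hilbert spaces, and $\Lambda_x:F(x)\to K_x$ is bounded linear for each $x\in X$. Definition. The family $\Lambda_{TU}=\{(F(x),\Lambda_x,v(x))\}_{x\in X}$ is a continuous $(T,U)$-controlled $g$-fusion frame for $H$ if (i) for each $f\in H$ the mapping $x\mapsto P_{F(x)}f$ is measurable, and (ii) there are constants $0<A\le B<\infty$ such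 that for all $f\in H$ $$A\|f\|^2\le\int_X v^2(x)\langle\Lambda_xP_{F(x)}Uf,\Lambda_xP_{F(x)}Tf\rangle\,d\mu_x\le B\|f\|^2 .$$ It is a continuous $g$-fusion frame for $H$ if this holds with $T=U=I_H$. It is understood that the formula for $S_{gF}$ defines a bounded (positive) operator on $H$. Standing convention: the positive operator $U$ commutes with the positive operators $T$ and $S_{gF}$. *)

(* Defs.v *)
From HB Require Import structures.
From mathcomp Require Import all_boot all_order all_algebra.
From mathcomp Require Import all_classical all_reals all_analysis.
From mathcomp Require Import complex.
Set Implicit Arguments.
Unset Strict Implicit.
Unset Printing Implicit Defensive.
Import Order.TTheory GRing.Theory Num.Theory.
Import numFieldNormedType.Exports.
Local Open Scope classical_set_scope.
Local Open Scope ring_scope.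

Variant scalar_kind := RealScalars | ComplexScalars.

Definition scalars (R : realType) (k : scalar_kind) : numFieldType :=
  match k with
  | RealScalars => R
  | ComplexScalars => R[i]
  end.

Definition scalar_conj {R : realType} {k : scalar_kind} :
    scalars R k -> scalars R k :=
  match k with
  | RealScalars => fun z => z
  | ComplexScalars => fun z => conjc z
  end.

Fact scalar_conj_is_zmod_morphism (R : realType) (k : scalar_kind) :
  zmod_morphism (@scalar_conj R k).
Proof. by case: k => // z w; exact: (rmorphB (@conjc R)). Qed.

Fact scalar_conj_is_monoid_morphism (R : realType) (k : scalar_kind) :
  monoid_morphism (@scalar_conj R k).
Proof.
by case: k; split=> //; [exact: (rmorph1 (@conjc R))|exact: (rmorphM (@conjc R))].
Qed.

HB.instance Definition _ (R : realType) (k : scalar_kind) :=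
  GRing.isZmodMorphism.Build _ _ (@scalar_conj R k)
    (@scalar_conj_is_zmod_morphism R k).
HB.instance Definition _ (R : realType) (k : scalar_kind) :=
  GRing.isMonoidMorphism.Build _ _ (@scalar_conj R k)
    (@scalar_conj_is_monoid_morphism R k).

Definition scalar_Re {R : realType} {k : scalar_kind} : scalars R k -> R :=
  match k with
  | RealScalars => fun z => z
  | ComplexScalars => fun z => complex.Re z
  end.

Definition scalar_Im {R : realType} {k : scalar_kind} : scalars R k -> R :=
  match k with
  | RealScalars => fun=> 0
  | ComplexScalars => fun z => complex.Im z
  end.

(* In the complex case this is a + ib.  In the real case b is dropped; every use
   below then has b = 0. *)
Definition mkscalar {R : realType} (k : scalar_kind) (a b : R) : scalars R k :=
  match k with
  | RealScalars => a
  | ComplexScalars => Complex a b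
  end.

(* The inner product is linear in its first argument and conjugate linear in
   the second one. *)
HB.mixin Record CompleteNormedModule_isHilbert (R : realType)
    (k : scalar_kind) H of CompleteNormedModule (scalars R k) H := {
  inner : {dot H for @scalar_conj R k};
  norm_inner : forall f : H, `|f| ^+ 2 = inner f f
}.

#[short(type="hilbertType")]
HB.structure Definition Hilbert (R : realType) (k : scalar_kind) :=
  { H of CompleteNormedModule (scalars R k) H &
         CompleteNormedModule_isHilbert R k H }.

Definition separable_space (V : topologicalType) :=
  exists D : set V, countable D /\ dense D.

Section ClosedSubspace.
Context (R : realType) (k : scalar_kind) (H : hilbertType R k).

Record closedSubspace := ClosedSubspace {
  csub_pred :> {pred H};
  csub_submod : submod_closed csub_pred;
  csub_closed : closed [set f | f \in csub_pred]
}.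

HB.instance Definition _ (M : closedSubspace) :=
  GRing.isSubmodClosed.Build _ _ (csub_pred M)
    (csub_submod M).

Record csub_of (M : closedSubspace) := CSub {
  csval : H;
  csvalP : csval \in csub_pred M
}.

HB.instance Definition _ (M : closedSubspace) := [isSub for @csval M].
HB.instance Definition _ (M : closedSubspace) := [Choice of csub_of M by <:].
HB.instance Definition _ (M : closedSubspace) :=
  [SubChoice_isSubLmodule of csub_of M by <:].

(* [orthproj M f] is the point p of M such that f - p is orthogonal to M; it exists
   and is unique by the projection theorem, so the default value 0 of [xget] is
   never used. *)
Definition orthproj (M : closedSubspace) (f : H) : csub_of M :=
  xget 0 [set p | forall m : csub_of M, inner (f - csval p) (csval m) = 0].

(* The inner product of [csub_of M] is the restriction of that of H.  When L is
   linear and bounded, the adjoint exists by the Riesz representation theorem,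
   and the default value 0 of [xget] is again never used. *)
Definition adjoint_sub (M : closedSubspace) (G : hilbertType R k)
    (L : csub_of M -> G) (y : G) : csub_of M :=
  xget 0 [set p | forall m : csub_of M,
                    inner (L m) y = inner (csval m) (csval p)].

Definition bounded_sub (M : closedSubspace) (G : hilbertType R k)
    (L : csub_of M -> G) :=
  exists C : scalars R k, forall m, `|L m| <= C * `|csval m|.

Definition bounded_op (S : H -> H) :=
  exists C : scalars R k, forall f, `|S f| <= C * `|f|.

Definition selfadjoint_op (S : H -> H) :=
  forall f g, inner (S f) g = inner f (S g).

(* In the complex case, 0 <= z in R[i] means that z is a nonnegative real. *)
Definition positive_op (S : H -> H) :=
  selfadjoint_op S /\ forall f, 0 <= inner (S f) f.

Definition GBplus (S : {linear H -> H}) :=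
  [/\ positive_op S, bounded_op S &
      exists S' : {linear H -> H},
        [/\ bounded_op S', cancel S S' & cancel S' S]].

Definition commuting (S T : H -> H) := forall f, S (T f) = T (S f).

End ClosedSubspace.

Section ScalarIntegral.
Context (R : realType) (k : scalar_kind) (d : measure_display)
  (X : measurableType d) (mu : {measure set X -> \bar R}).
Implicit Type h : X -> scalars R k.

Definition scalar_integrable h :=
  mu.-integrable setT (fun x => (scalar_Re (h x))%:E) /\
  mu.-integrable setT (fun x => (scalar_Im (h x))%:E).

Definition scalar_integral h : scalars R k :=
  mkscalar k (\int[mu]_x scalar_Re (h x)) (\int[mu]_x scalar_Im (h x)).

End ScalarIntegral.

Section Frames.
Context (R : realType) (k : scalar_kind) (H : hilbertType R k)
  (d : measure_display) (X : measurableType d) (mu : {measure set X -> \bar R})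
  (F : X -> closedSubspace H) (K : X -> hilbertType R k)
  (Lambda : forall x, {linear csub_of (F x) -> K x}) (v : X -> R).

(* Measurability with respect to the Borel sets of the norm topology. *)
Definition borel_measurable (g : X -> H) :=
  forall O : set H, open O -> measurable (g @^-1` O).

Definition weight (x : X) : scalars R k := mkscalar k (v x ^+ 2) 0.

(* The frame bounds are scalars: 0 < A and A <= B force them to be real.  In the
   complex case the two inequalities for the integral say that it is real and
   lies between the two bounds. *)
Definition continuous_controlled_gfusion_frame (T U : H -> H) :=
  (forall f, borel_measurable (fun x => csval (orthproj (F x) f))) /\
  exists A B : scalars R k, [/\ 0 < A, A <= B &
    forall f : H,
      let h x := weight x * inner (Lambda x (orthproj (F x) (U f)))
                                  (Lambda x (orthproj (F x) (T f))) in
      scalar_integrable mu h /\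
      A * `|f| ^+ 2 <= scalar_integral mu h <= B * `|f| ^+ 2].

Definition continuous_gfusion_frame :=
  continuous_controlled_gfusion_frame idfun idfun.

Definition gfusion_frame_operator (S : H -> H) :=
  forall f : H,
    let h x := weight x *
      inner (csval (adjoint_sub (Lambda x) (Lambda x (orthproj (F x) f)))) f in
    scalar_integrable mu h /\ inner (S f) f = scalar_integral mu h.

End Frames.

(* Main.v *)
From HB Require Import structures.
Require Import Defs.
From mathcomp Require Import all_boot all_order all_algebra.
From mathcomp Require Import all_classical all_reals all_analysis.
From mathcomp Require Import complex ring lra.
Import Order.TTheory GRing.Theory Num.Theory.
Import numFieldNormedType.Exports.
Set Implicit Arguments.
Unset Strict Implicit.
Unset Printing Implicit Defensive.
Local Open Scope classical_set_scope.
Local Open Scope ring_scope.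

(** Polarising the identity that defines the frame operator [S] gives
    [<S f, g> = int v^2 <Lambda P f, Lambda P g>] for all [f] and [g]
    ([frame_form_integral]).  At [U f] and [T f], where [T] is self-adjoint,
    the controlled integral becomes [<T S U f, f>], and the three operators
    commute, so it is [<W S f, f>] with [W = U T].  Measurability of the
    projections is common to both notions, and the upper frame bounds follow
    from boundedness, so the theorem says that [W S] is bounded below by a
    positive constant if and only if [S] is ([controlled_frameP]).

    Both implications are instances of [coercive_comp]: if [W] is positive with
    bounded inverse and commutes with a symmetric [Q >= a > 0], then [W Q] is
    coercive.  Indeed the product of two commuting positive operators is
    positive ([nonneg_comp]), hence [W (Q - a) >= 0]; and if [W^-1 <= c] then
    [W (c - W^-1) >= 0], that is, [c W >= 1]; so [W Q >= a W >= a / c].  One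
    takes [Q = S], and for the converse [W^-1] in place of [W] and [Q = W S].
    That [W] itself is positive is again [nonneg_comp].

    Positivity of a commuting product [B A] is proved without square roots:
    after scaling to [A <= 1], the recursion [A_0 = A],
    [A_(n+1) = A_n - A_n^2] of F. Riesz expresses [A] as a sum of squares
    [A_k^2], and [<B A_k^2 f, f> = <B A_k f, A_k f> >= 0].

    Polarisation needs linearity of the orthogonal projections and the defining
    property of the adjoints, that is, the projection theorem and the Riesz
    representation theorem on a closed subspace.  Both come from one
    minimisation argument ([real_riesz]).

    Inequalities are handled with the real inner product [rip], the real part
    of [inner], which treats real and complex scalars alike; self-adjoint
    operators are symmetric for it, and imaginary parts are recovered through
    [scalar_Im_Re]. *)

(** * Real scalars *)

Section Scalars.
Context (R : realType) (k : scalar_kind).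
Implicit Types (a b c : R) (z w : scalars R k).

Definition real_scalar a : scalars R k := mkscalar k a 0.

Definition im_unit : scalars R k := mkscalar k 0 1.

Lemma scalar_eq z w :
  scalar_Re z = scalar_Re w -> scalar_Im z = scalar_Im w -> z = w.
Proof.
rewrite /scalar_Re /scalar_Im; case: k z w => //= [] [z1 z2] [w1 w2] /=.
by move=> -> ->.
Qed.

Lemma scalar_Re_mk a b : scalar_Re (mkscalar k a b) = a.
Proof. by case: k. Qed.

Lemma scalar_Re_rs a : scalar_Re (real_scalar a) = a.
Proof. exact: scalar_Re_mk. Qed.

Lemma scalar_Im_rs a : scalar_Im (real_scalar a) = 0.
Proof. by rewrite /real_scalar; case: k. Qed.

Lemma mkscalarK z : mkscalar k (scalar_Re z) (scalar_Im z) = z.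
Proof. by case: k z => //= -[]. Qed.

Lemma scalar_Re0 : scalar_Re (0 : scalars R k) = 0.
Proof. by case: k. Qed.

Lemma scalar_ReD z w : scalar_Re (z + w) = scalar_Re z + scalar_Re w.
Proof. by case: k z w => //= -[? ?] [? ?]. Qed.

Lemma scalar_ReM_rs a z : scalar_Re (real_scalar a * z) = a * scalar_Re z.
Proof.
by rewrite /real_scalar; case: k z => //= -[? ?] /=; rewrite mul0r subr0.
Qed.

Lemma scalar_Re_conj z : scalar_Re (scalar_conj z) = scalar_Re z.
Proof. by case: k z => //= -[]. Qed.

Lemma real_scalar_is_zmod_morphism : zmod_morphism real_scalar.
Proof.
rewrite /real_scalar; case: k => a b //=.
by apply/eqP; rewrite eq_complex /= subr0 !eqxx.
Qed.

Lemma real_scalar_is_monoid_morphism : monoid_morphism real_scalar.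
Proof.
rewrite /real_scalar; case: k; split=> //= a b.
by apply/eqP; rewrite eq_complex /= !mulr0 mul0r subr0 addr0 !eqxx.
Qed.

HB.instance Definition _ :=
  GRing.isZmodMorphism.Build _ _ real_scalar real_scalar_is_zmod_morphism.
HB.instance Definition _ :=
  GRing.isMonoidMorphism.Build _ _ real_scalar real_scalar_is_monoid_morphism.

(** For real scalars [im_unit] is 0 and this reads 0 = 0; so imaginary parts
    are recovered from real parts uniformly in the kind of scalars. *)
Lemma scalar_Im_Re z : scalar_Im z = scalar_Re (scalar_conj im_unit * z).
Proof.
rewrite /im_unit; case: k z => /= [?|[x y]] /=; first by rewrite mul0r.
by rewrite mul0r mulN1r opprK add0r.
Qed.

Lemma scalar_le z w :
  (z <= w) = (scalar_Im w == scalar_Im z) && (scalar_Re z <= scalar_Re w).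
Proof. by case: k z w => /= [z w|z w]; rewrite ?eqxx // lecE. Qed.

Lemma scalar_Re_le z w : z <= w -> scalar_Re z <= scalar_Re w.
Proof. by rewrite scalar_le => /andP[]. Qed.

Lemma real_scalar_le a b : (real_scalar a <= real_scalar b) = (a <= b).
Proof. by rewrite scalar_le !scalar_Im_rs !scalar_Re_rs eqxx. Qed.

Lemma real_scalar_lt a b : (real_scalar a < real_scalar b) = (a < b).
Proof.
by rewrite !lt_neqAle real_scalar_le (inj_eq (fmorph_inj real_scalar)).
Qed.

Lemma real_scalar_ge0 z : 0 <= z -> z = real_scalar (scalar_Re z).
Proof.
rewrite -(rmorph0 real_scalar) scalar_le scalar_Im_rs => /andP[/eqP zi _].
by apply: scalar_eq; rewrite ?scalar_Re_rs ?scalar_Im_rs.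
Qed.

Lemma real_scalar_conj z : scalar_conj z = z -> z = real_scalar (scalar_Re z).
Proof.
rewrite /real_scalar; case: k z => //= -[x y] /= [] yN.
by rewrite [y](_ : _ = 0) //; lra.
Qed.

End Scalars.

(** * The real inner product *)

Section RealInner.
Context (R : realType) (k : scalar_kind) (H : hilbertType R k).
Implicit Types (f g h : H) (a : R).

Definition rip f g : R := scalar_Re (inner f g).

Local Notation rscale a f := (real_scalar k a *: f).

Lemma innerC f g : inner f g = scalar_conj (inner g f).
Proof. by rewrite hermC expr0 mul1r. Qed.

Lemma innerDl f g h : inner (f + g) h = inner f h + inner g h.
Proof. exact: linearDl. Qed.

Lemma innerBl f g h : inner (f - g) h = inner f h - inner g h.
Proof. exact: linearBl. Qed.

Lemma innerZl (z : scalars R k) f h : inner (z *: f) h = z * inner f h.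
Proof. exact: linearZl_LR. Qed.

Lemma innerZr (z : scalars R k) f h :
  inner h (z *: f) = scalar_conj z * inner h f.
Proof. exact: linearZr_LR. Qed.

Lemma ripC f g : rip f g = rip g f.
Proof. by rewrite /rip innerC scalar_Re_conj. Qed.

Lemma ripDl f g h : rip (f + g) h = rip f h + rip g h.
Proof. by rewrite /rip innerDl scalar_ReD. Qed.

Lemma ripDr f g h : rip h (f + g) = rip h f + rip h g.
Proof. by rewrite ripC ripDl !(ripC h). Qed.

Lemma ripZl a f h : rip (rscale a f) h = a * rip f h.
Proof. by rewrite /rip innerZl scalar_ReM_rs. Qed.

Lemma ripZr a f h : rip h (rscale a f) = a * rip h f.
Proof. by rewrite ripC ripZl ripC. Qed.

Lemma ripNl f h : rip (- f) h = - rip f h.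
Proof. by rewrite -scaleN1r -(rmorphN1 (real_scalar k)) ripZl mulN1r. Qed.

Lemma ripNr f h : rip h (- f) = - rip h f.
Proof. by rewrite ripC ripNl ripC. Qed.

Lemma rip0l h : rip 0 h = 0.
Proof. by rewrite -(subrr h) ripDl ripNl subrr. Qed.

Lemma rip_norm f : `|f| ^+ 2 = real_scalar k (rip f f).
Proof. by rewrite norm_inner -real_scalar_ge0 // -norm_inner exprn_ge0. Qed.

Lemma rip_ge0 f : 0 <= rip f f.
Proof. by rewrite -(real_scalar_le k) -rip_norm rmorph0 exprn_ge0. Qed.

Lemma rip_eq0 f : rip f f = 0 -> f = 0.
Proof.
move=> f0; apply/eqP; rewrite -normr_eq0.
by rewrite -[_ == 0]/((0 < 2)%N && _) -expf_eq0 rip_norm f0 rmorph0.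
Qed.

Lemma rip_ext f g : (forall h, rip f h = rip g h) -> f = g.
Proof.
move=> fg; apply/eqP; rewrite -subr_eq0; apply/eqP/rip_eq0.
by rewrite ripDl ripNl fg subrr.
Qed.

(** Nonnegativity of [<h, h>] for [h = <g, g> f - <f, g> g], divided by
    [<g, g>]. *)
Lemma rip_CS f g : rip f g ^+ 2 <= rip f f * rip g g.
Proof.
have [g0|g0] := eqVneq (rip g g) 0.
  rewrite (rip_eq0 g0) (ripC f) !rip0l; lra.
have {}g0 : 0 < rip g g by rewrite lt_neqAle eq_sym g0 rip_ge0.
have := rip_ge0 (rscale (rip g g) f - rscale (rip f g) g).
rewrite !(ripDl, ripDr, ripNl, ripNr, ripZl, ripZr) (ripC g f) => h.
rewrite -subr_ge0 -(pmulr_rge0 _ g0); nra.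
Qed.

Definition rnorm f : R := scalar_Re `|f|.

Lemma rnormE f : `|f| = real_scalar k (rnorm f).
Proof. exact: real_scalar_ge0. Qed.

Lemma rnorm_ge0 f : 0 <= rnorm f.
Proof. by rewrite -(real_scalar_le k) -rnormE rmorph0. Qed.

Lemma sqr_rnorm f : rnorm f ^+ 2 = rip f f.
Proof.
by apply: (fmorph_inj (real_scalar k)); rewrite rmorphXn /= -rnormE rip_norm.
Qed.

Lemma rip_le_rnorm f g : `|rip f g| <= rnorm f * rnorm g.
Proof.
rewrite -(@ler_pXn2r _ 2) ?nnegrE ?mulr_ge0 ?rnorm_ge0 //.
by rewrite real_normK ?num_real // exprMn !sqr_rnorm rip_CS.
Qed.

End RealInner.

(** * Products of commuting positive operators *)

Section SymmetricOperators.
Context (R : realType) (k : scalar_kind) (H : hilbertType R k).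
Implicit Types (f g : H) (A B Q W : H -> H) (a c : R).

Local Notation rscale a f := (real_scalar k a *: f).

Definition symmetric_op Q := forall f g, rip (Q f) g = rip f (Q g).

Definition nonneg_op Q := forall f, 0 <= rip (Q f) f.

Definition coercive Q :=
  exists2 a, 0 < a & forall f, a * rip f f <= rip (Q f) f.

Definition form_bounded Q :=
  exists2 c, 0 < c & forall f, rip (Q f) f <= c * rip f f.

Definition norm_bounded Q :=
  exists2 c, 0 < c & forall f, rnorm (Q f) <= c * rnorm f.

(** No linearity is assumed of operators in this part: a map that is symmetric
    for [rip] is linear over the reals, because [rip] separates points. *)
Lemma symmetricD Q f g : symmetric_op Q -> Q (f + g) = Q f + Q g.
Proof. by move=> sQ; apply: rip_ext => h; rewrite ripDl !sQ ripDl. Qed.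

Lemma symmetricN Q f : symmetric_op Q -> Q (- f) = - Q f.
Proof. by move=> sQ; apply: rip_ext => h; rewrite ripNl !sQ ripNl. Qed.

Lemma symmetricZ Q a f : symmetric_op Q -> Q (rscale a f) = rscale a (Q f).
Proof. by move=> sQ; apply: rip_ext => h; rewrite ripZl !sQ ripZl. Qed.

Lemma symmetric_comp Q W :
  symmetric_op Q -> symmetric_op W -> commuting Q W -> symmetric_op (Q \o W).
Proof. by move=> sQ sW QW f g /=; rewrite sQ sW QW. Qed.

Lemma symmetric_inv Q W :
  symmetric_op Q -> cancel W Q -> symmetric_op W.
Proof. by move=> sQ WK f g; rewrite -{1}(WK g) -sQ WK. Qed.

(** F. Riesz's iteration, whose successive differences are squares: they add up
    to [A] while each of them commutes with whatever commutes with [A]. *)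
Fixpoint riesz_seq A n : H -> H :=
  if n is n'.+1 then
    fun f => riesz_seq A n' f - riesz_seq A n' (riesz_seq A n' f)
  else A.

Lemma riesz_seq_symmetric A n : symmetric_op A -> symmetric_op (riesz_seq A n).
Proof.
move=> sA; elim: n => //= n IH f g.
by rewrite ripDl ripDr ripNl ripNr !IH.
Qed.

Lemma riesz_seq_commuting A B n :
  symmetric_op B -> commuting B A -> commuting B (riesz_seq A n).
Proof.
move=> sB BA; elim: n => //= n IH f.
by rewrite symmetricD // symmetricN // !IH.
Qed.

(** Each step maps the order interval from 0 to 1 to itself, because
    [P - P^2 = P^2 (1 - P) + P (1 - P)^2] and
    [1 - (P - P^2) = (1 - P) + P^2]. *)
Lemma riesz_seq_range A n :
  symmetric_op A -> nonneg_op A -> (forall f, rip (A f) f <= rip f f) ->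
  nonneg_op (riesz_seq A n) /\ forall f, rip (riesz_seq A n f) f <= rip f f.
Proof.
move=> sA A0 A1; elim: n => //= n [P0 P1].
have := riesz_seq_symmetric n sA.
move: (riesz_seq A n) P0 P1 => P P0 P1 sP; split=> f.
  have := P0 (f - P f); have := P1 (P f).
  rewrite !(symmetricD, symmetricN, ripDl, ripDr, ripNl, ripNr) //.
  rewrite !sP => ? ?; lra.
rewrite ripDl ripNl (sP (P f)); have := P1 f; have := rip_ge0 (P f) => ? ?; lra.
Qed.

(** Summing [P_k^2 = P_k - P_(k+1)] telescopes. *)
Lemma riesz_seq_sum A n f :
  symmetric_op A -> nonneg_op A -> (forall f, rip (A f) f <= rip f f) ->
  \sum_(i < n) rip (riesz_seq A i f) (riesz_seq A i f) <= rip (A f) f.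
Proof.
move=> sA A0 A1.
suff -> : \sum_(i < n) rip (riesz_seq A i f) (riesz_seq A i f) =
          rip (A f) f - rip (riesz_seq A n f) f.
  by rewrite gerBl; have [+ _] := riesz_seq_range n sA A0 A1; exact.
elim: n => [|n IH]; first by rewrite big_ord0 subrr.
rewrite big_ord_recr /= IH !ripDl ripNl.
rewrite (riesz_seq_symmetric n sA (riesz_seq A n f)); lra.
Qed.

(** [B A_n - B A_(n+1) = B A_n^2 = A_n B A_n] is nonnegative. *)
Lemma riesz_seq_le A B n f :
  symmetric_op B -> nonneg_op B -> symmetric_op A -> commuting B A ->
  rip (B (riesz_seq A n f)) f <= rip (B (A f)) f.
Proof.
move=> sB B0 sA BA; elim: n => //= n; apply: le_trans.
have sP := riesz_seq_symmetric n sA; have BP := riesz_seq_commuting n sB BA.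
rewrite symmetricD // symmetricN // ripDl ripNl gerBl BP sP; exact: B0.
Qed.

(** Suppose [<B A f, f> = e < 0].  Then [<A_n f, B f> <= e] for all [n] by
    [riesz_seq_le], so Cauchy-Schwarz bounds [|A_n f|^2] away from 0, whereas
    the series of the [|A_n f|^2] is bounded by [riesz_seq_sum]. *)
Lemma nonneg_comp_contraction A B :
  symmetric_op A -> nonneg_op A -> (forall f, rip (A f) f <= rip f f) ->
  symmetric_op B -> nonneg_op B -> commuting B A ->
  nonneg_op (B \o A).
Proof.
move=> sA A0 A1 sB B0 BA f /=; rewrite leNgt; apply/negP => neg.
set e := rip (B (A f)) f in neg *.
have lb n : e ^+ 2 <= rip (riesz_seq A n f) (riesz_seq A n f) * rip (B f) (B f).
  apply: le_trans (rip_CS _ _); rewrite -sB.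
  by have := riesz_seq_le n f sB B0 sA BA; rewrite -/e => ?; nra.
have ub n : e ^+ 2 *+ n <= rip (A f) f * rip (B f) (B f).
  apply: le_trans (ler_wpM2r (rip_ge0 _) (riesz_seq_sum n f sA A0 A1)).
  rewrite mulr_suml -[X in _ *+ X]card_ord -sumr_const.
  by apply: ler_sum => i _; exact: lb.
have e2 : 0 < e ^+ 2 by rewrite exprn_even_gt0 //= lt_eqF.
pose b := rip (A f) f * rip (B f) (B f).
have b0 : 0 <= b / e ^+ 2 
  by apply: divr_ge0; [apply: mulr_ge0; [exact: A0|exact: rip_ge0]|exact: ltW].
have := archi_boundP b0.
rewrite ltr_pdivrMr // mulr_natl ltNge => /negP; apply; exact: ub.
Qed.

Lemma nonneg_comp A B :
  symmetric_op A -> nonneg_op A -> form_bounded A ->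
  symmetric_op B -> nonneg_op B -> commuting B A ->
  nonneg_op (B \o A).
Proof.
move=> sA A0 [c c0 Ac] sB B0 BA f /=.
pose A' g := rscale c^-1 (A g).
have ci0 : 0 < c^-1 by rewrite invr_gt0.
have : 0 <= rip (B (A' f)) f.
  apply: nonneg_comp_contraction => //.
  - by move=> g h; rewrite ripZl ripZr sA.
  - by move=> g; rewrite ripZl mulr_ge0 // ltW.
  - by move=> g; rewrite ripZl mulrC ler_pdivrMr // mulrC.
  - by move=> g; rewrite /A' symmetricZ // BA.
by rewrite symmetricZ // ripZl pmulr_rge0.
Qed.

Lemma symmetric_sub c W :
  symmetric_op W -> symmetric_op (fun f => W f - rscale c f).
Proof. by move=> sW f g; rewrite ripDl ripDr ripNl ripNr ripZl ripZr sW. Qed.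

(** With [W' <= c] and [Q >= a]: positivity of [(c - W') W] gives [c W >= 1],
    positivity of [(Q - a) W] gives [W Q >= a W], so [W Q >= a / c]. *)
Lemma coercive_comp W W' Q :
  symmetric_op W -> nonneg_op W -> form_bounded W ->
  cancel W W' -> cancel W' W -> form_bounded W' ->
  symmetric_op Q -> coercive Q -> commuting Q W ->
  coercive (W \o Q).
Proof.
move=> sW W0 Wb WK W'K [c c0 W'c] sQ [a a0 Qa] QW.
have sW' := symmetric_inv sW W'K.
have cW f : rip f f <= c * rip (W f) f.
  pose B g := rscale c g - W' g.
  have : 0 <= rip (B (W f)) f.
    apply: (@nonneg_comp W B) => // [g h|g|g].
    - by rewrite ripDl ripDr ripNl ripNr ripZl ripZr sW'.
    - by rewrite ripDl ripNl ripZl subr_ge0.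
    - rewrite /B (symmetricD _ _ sW) (symmetricN _ sW) (symmetricZ _ _ sW).
      by rewrite WK W'K.
  by rewrite ripDl ripNl ripZl WK subr_ge0.
have WQ f : a * rip (W f) f <= rip (W (Q f)) f.
  have : 0 <= rip (Q (W f) - rscale a (W f)) f.
    apply: (nonneg_comp sW W0 Wb (symmetric_sub a sQ)) => g.
    - by rewrite ripDl ripNl ripZl subr_ge0.
    - by rewrite (symmetricD _ _ sW) (symmetricN _ sW) (symmetricZ _ _ sW) QW.
  by rewrite ripDl ripNl ripZl subr_ge0 QW.
exists (a / c) => [|f]; first by rewrite divr_gt0.
apply: le_trans (WQ f); rewrite -mulrA ler_pM2l // mulrC ler_pdivrMr //.
by rewrite mulrC.
Qed.

Lemma bounded_opP Q : bounded_op Q -> norm_bounded Q.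
Proof.
move=> [C QC]; exists (`|scalar_Re C| + 1) => [|f]; first by rewrite ltr_wpDl.
have := scalar_Re_le (QC f); rewrite (rnormE f) mulrC scalar_ReM_rs mulrC => Qf.
apply: le_trans Qf _.
by rewrite ler_wpM2r ?rnorm_ge0 // ler_wpDr // ler_norm.
Qed.

Lemma norm_bounded_comp Q W :
  norm_bounded Q -> norm_bounded W -> norm_bounded (Q \o W).
Proof.
move=> [c c0 Qc] [b b0 Wb]; exists (c * b) => [|f]; first exact: mulr_gt0.
by apply: le_trans (Qc _) _; rewrite -mulrA ler_pM2l.
Qed.

Lemma norm_bounded_form Q : norm_bounded Q -> form_bounded Q.
Proof.
move=> [c c0 Qc]; exists c => // f; apply: le_trans (ler_norm _) _.
apply: le_trans (rip_le_rnorm _ _) _.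
by rewrite -sqr_rnorm expr2 mulrA ler_wpM2r ?rnorm_ge0.
Qed.

End SymmetricOperators.

(** * Riesz representation on a closed subspace *)

Section Riesz.
Context (R : realType) (k : scalar_kind) (H : hilbertType R k).
Variable M : closedSubspace H.
Implicit Types (m : csub_of M) (a c : R).

Lemma csvalD m m' : csval (m + m') = csval m + csval m'.
Proof. by []. Qed.

Lemma csvalZ (z : scalars R k) m : csval (z *: m) = z *: csval m.
Proof. by []. Qed.

(** The representing vector minimises [J m = |m|^2 - 2 r m], which is bounded
    below by [- c^2].  The parallelogram law makes a minimising sequence [u]
    Cauchy; its limit [p] lies in [M] because [M] is closed.  Near-minimality of
    [u n] along each direction [m] forces [<m, u n> - r m] to tend to 0, so
    continuity of [J] is not involved. *)
Lemma real_riesz (r : csub_of M -> R) c :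
  (forall m m', r (m + m') = r m + r m') ->
  (forall a m, r (real_scalar k a *: m) = a * r m) ->
  (forall m, `|r m| <= c * rnorm (csval m)) ->
  exists p : csub_of M, forall m, r m = rip (csval m) (csval p).
Proof.
move=> rD rZ rc.
pose J m := rip (csval m) (csval m) - r m *+ 2.
have Jinf : has_inf (range J).
  split; first by exists (J 0), 0.
  exists (- c ^+ 2) => _ [m _ <-]; rewrite /J -sqr_rnorm.
  have := le_trans (ler_norm _) (rc m) => h.
  have := sqr_ge0 (rnorm (csval m) - c) => ?; nra.
pose i := inf (range J).
have iJ m : i <= J m by apply: ge_inf; [case: Jinf|exists m].
have /choice[u uJ] n : exists m, J m <= i + n.+1%:R^-1.
  have n0 : 0 < (n.+1%:R : R)^-1 by rewrite invr_gt0.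
  by have [_ [m _ <-] /ltW] := inf_adherent n0 Jinf; exists m.
have uC n l : rnorm (csval (u n) - csval (u l)) ^+ 2 <=
    (n.+1%:R^-1 + l.+1%:R^-1) *+ 2.
  have := iJ (real_scalar k 2^-1 *: (u n + u l)); have := uJ n; have := uJ l.
  rewrite sqr_rnorm /J csvalZ csvalD rZ rD.
  rewrite !(ripDl, ripDr, ripNl, ripNr, ripZl, ripZr).
  rewrite (ripC (csval (u l)) (csval (u n))).
  move: (n.+1%:R^-1) (l.+1%:R^-1) => dn dl *; lra.
have /cvg_ex[/= p up] : cvg ((fun n => csval (u n)) @ \oo).
  apply: cauchy_cvg; apply: cauchy_exP => e e0.
  have eE := real_scalar_ge0 (ltW e0); set a := scalar_Re e in eE.
  have a0 : 0 < a by rewrite -(real_scalar_lt k) rmorph0 -eE.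
  have a4 : 0 < a ^+ 2 / 4 by rewrite divr_gt0 // exprn_gt0.
  have [N _ Na] := near_infty_natSinv_lt (PosNum a4).
  exists (csval (u N)); exists N => // n /= Nn.
  rewrite -ball_normE /ball_ /= rnormE eE real_scalar_lt.
  rewrite -(@ltr_pXn2r _ 2) ?nnegrE ?rnorm_ge0 ?(ltW a0) //.
  apply: le_lt_trans (uC _ _) _.
  have := Na N (leqnn N); have := Na n Nn => /=.
  move: (N.+1%:R^-1) (n.+1%:R^-1) => dN dn.
  by move=> *; lra.
have Mp : p \in csub_pred M.
  apply: (closed_cvg _ (@csub_closed _ _ _ M) _ _ up).
  by apply: nearW => n /=; exact: csvalP.
exists (CSub Mp) => m /=.
(* [J (u n + t m) >= i >= J (u n) - 1 / (n + 1)] is quadratic in [t]; the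
   minimiser is - al / be, and be + 1 avoids the case be = 0. *)
have crit n : (rip (csval m) (csval (u n)) - r m) ^+ 2 <=
    n.+1%:R^-1 * (rip (csval m) (csval m) + 1).
  set al := _ - r m; set be := rip (csval m) (csval m).
  have be0 : 0 <= be by exact: rip_ge0.
  have be1 : 0 < be + 1 by rewrite ltr_wpDl.
  have [t tE] : exists t, t * (be + 1) = - al.
    by exists (- al / (be + 1)); rewrite mulfVK // gt_eqF.
  have : 0 <= n.+1%:R^-1 + t * al *+ 2 + t ^+ 2 * be.
    have := iJ (u n + real_scalar k t *: m); have := uJ n.
    rewrite /J rD rZ csvalD csvalZ !(ripDl, ripDr, ripZl, ripZr).
    rewrite (ripC (csval (u n)) (csval m)) -/be.
    rewrite /al; move: (n.+1%:R^-1) => dn h1 h2.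
    nra.
  have alE : al = - (t * (be + 1)) by rewrite tE opprK.
  rewrite alE sqrrN exprMn [(be + 1) ^+ 2]expr2 mulrA => h.
  rewrite ler_wpM2r ?(ltW be1) //; move: h (sqr_ge0 t).
  move: (n.+1%:R^-1) => dn h t2; nra.
apply/eqP; rewrite -subr_eq0 -normr_le0 leNgt; apply/negP => x0.
set x := `|_| in x0; pose y := rnorm (csval m) + 1.
have y0 : 0 < y by rewrite ltr_wpDl ?rnorm_ge0.
pose e := x / 2 / y; have e0 : 0 < e by rewrite !divr_gt0.
have z0 : 0 < rip (csval m) (csval m) + 1 by rewrite ltr_wpDl ?rip_ge0.
have d0 : 0 < e ^+ 2 / (rip (csval m) (csval m) + 1).
  by rewrite divr_gt0 // exprn_gt0.
have e0' : 0 < real_scalar k e.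
  by rewrite -(rmorph0 (real_scalar k)) real_scalar_lt.
have [N _ Nd] := near_infty_natSinv_lt (PosNum d0).
have [N' _ Np] := (cvgrPdist_lt _ _).1 up _ e0'.
pose n := maxn N N'.
have /= := Nd n (leq_maxl _ _); rewrite ltr_pdivlMr // => dn.
have /= := Np n (leq_maxr _ _); rewrite rnormE real_scalar_lt => pn.
have a_lt : `|rip (csval m) (csval (u n)) - r m| < e.
  rewrite -(@ltr_pXn2r _ 2) ?nnegrE ?(ltW e0) //.
  by rewrite real_normK ?num_real //; apply: le_lt_trans (crit n) dn.
have : x < e * y.
  rewrite /x distrC mulrDr mulr1.
  rewrite (_ : rip _ p - r m = rip (csval m) (p - csval (u n)) +
                         (rip (csval m) (csval (u n)) - r m)); last first.
    by rewrite ripDr ripNr addrA subrK.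
  apply: le_lt_trans (ler_normD _ _) (ler_ltD _ a_lt).
  apply: le_trans (rip_le_rnorm _ _) _.
  by rewrite mulrC ler_wpM2r ?rnorm_ge0 // ltW.
rewrite divfK ?gt_eqF //; lra.
Qed.

(** The real case applied to the real part of [phi]; the imaginary part follows
    by evaluating at a multiple of [m]. *)
Lemma riesz (phi : csub_of M -> scalars R k) c :
  (forall m m', phi (m + m') = phi m + phi m') ->
  (forall z m, phi (z *: m) = z * phi m) ->
  (forall m, `|scalar_Re (phi m)| <= c * rnorm (csval m)) ->
  exists p : csub_of M, forall m, phi m = inner (csval m) (csval p).
Proof.
move=> phiD phiZ phic.
have [||//|p pE] := @real_riesz (fun m => scalar_Re (phi m)) c.
- by move=> m m'; rewrite phiD scalar_ReD.
- by move=> a m; rewrite phiZ scalar_ReM_rs.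
exists p => m; apply: scalar_eq; first exact: pE.
by rewrite !scalar_Im_Re -phiZ pE csvalZ /rip innerZl.
Qed.

(** The projection of [f] represents the functional [m |-> <m, f>]. *)
Lemma orthprojP f m : inner (f - csval (orthproj M f)) (csval m) = 0.
Proof.
suff [p pE] : exists p : csub_of M,
    forall m, inner (f - csval p) (csval m) = 0.
  by move: m; rewrite /orthproj; case: xgetP => [q -> //|/(_ p)].
have [||m'|p pE] := @riesz (fun m => inner (csval m) f) (rnorm f).
- by move=> m1 m2; rewrite csvalD innerDl.
- by move=> z m1; rewrite csvalZ innerZl.
- by rewrite mulrC; exact: rip_le_rnorm.
by exists p => m'; rewrite innerBl [inner f _]innerC pE -innerC subrr.
Qed.

Lemma orthproj_unique f p :
  (forall m, inner (f - csval p) (csval m) = 0) -> p = orthproj M f.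
Proof.
move=> pE; apply/val_inj/eqP; rewrite -subr_eq0; apply/eqP/rip_eq0.
set q := orthproj M f; rewrite -[_ - _]/(csval (p - q)) /rip.
have pqE : csval (p - q) = (f - csval q) - (f - csval p).
  by rewrite opprB [RHS]addrC subrKA.
rewrite {1}pqE; move: (p - q) => r.
by rewrite innerBl pE orthprojP subrr scalar_Re0.
Qed.

Lemma orthprojD f g : orthproj M (f + g) = orthproj M f + orthproj M g.
Proof.
apply/esym/orthproj_unique => m.
by rewrite csvalD opprD addrACA innerDl !orthprojP addr0.
Qed.

Lemma orthprojZ (z : scalars R k) f : orthproj M (z *: f) = z *: orthproj M f.
Proof.
apply/esym/orthproj_unique => m.
by rewrite csvalZ -scalerBr innerZl orthprojP mulr0.
Qed.

(** The adjoint at [y] represents the functional [m |-> <L m, y>], which is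
    bounded since [L] is. *)
Lemma adjoint_subP (G : hilbertType R k) (L : {linear csub_of M -> G}) y m :
  bounded_sub L -> inner (L m) y = inner (csval m) (csval (adjoint_sub L y)).
Proof.
move=> [C LC].
suff [p pE] : exists p : csub_of M,
    forall m, inner (L m) y = inner (csval m) (csval p).
  by move: m; rewrite /adjoint_sub; case: xgetP => [q -> //|/(_ p)].
apply: (@riesz (fun m => inner (L m) y) (scalar_Re C * rnorm y)).
- by move=> m1 m2; rewrite raddfD innerDl.
- by move=> z m1; rewrite linearZ innerZl.
move=> m'; apply: le_trans (rip_le_rnorm _ _) _.
rewrite mulrAC ler_wpM2r ?rnorm_ge0 //.
have := scalar_Re_le (LC m'); rewrite (rnormE (csval m')) mulrC scalar_ReM_rs.
by rewrite mulrC.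
Qed.

End Riesz.

(** * The frame operator as a sesquilinear form *)

Section FrameForm.
Context (R : realType) (k : scalar_kind) (H : hilbertType R k)
  (d : measure_display) (X : measurableType d) (mu : {measure set X -> \bar R})
  (F : X -> closedSubspace H) (K : X -> hilbertType R k)
  (Lambda : forall x, {linear csub_of (F x) -> K x}) (v : X -> R).
Implicit Types (f g : H).

(** The integrand of the controlled frame inequality, as a sesquilinear form;
    [f] and [g] stand for [U f] and [T f]. *)
Definition frame_form f g x : scalars R k :=
  weight k v x *
    inner (Lambda x (orthproj (F x) f)) (Lambda x (orthproj (F x) g)).

Lemma frame_formZr f g (z : scalars R k) x :
  frame_form f (z *: g) x = scalar_conj z * frame_form f g x.
Proof. by rewrite /frame_form orthprojZ linearZ innerZr mulrCA. Qed.

Lemma Re_frame_form f g x : scalar_Re (frame_form f g x) =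
  v x ^+ 2 * rip (Lambda x (orthproj (F x) f)) (Lambda x (orthproj (F x) g)).
Proof. exact: scalar_ReM_rs. Qed.

Lemma frame_form_polar f g x :
  scalar_Re (frame_form f g x) =
  2^-1 * (scalar_Re (frame_form (f + g) (f + g) x) -
          (scalar_Re (frame_form f f x) + scalar_Re (frame_form g g x))).
Proof.
rewrite !Re_frame_form !orthprojD !raddfD !(ripDl, ripDr).
rewrite (ripC (Lambda x (orthproj (F x) g)) (Lambda x (orthproj (F x) f))).
by rewrite /=; field.
Qed.

Variable S : {linear H -> H}.
Hypothesis Lambda_bounded : forall x, bounded_sub (Lambda x).
Hypothesis S_sym : selfadjoint_op S.
Hypothesis S_frameop : gfusion_frame_operator mu Lambda v S.

(** The adjoint of [Lambda x] takes values in [F x], so [f] may be replaced by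
    its projection before moving the adjoint to the other side. *)
Lemma frame_form_diag f x :
  weight k v x *
    inner (csval (adjoint_sub (Lambda x) (Lambda x (orthproj (F x) f)))) f =
  frame_form f f x.
Proof.
rewrite /frame_form; congr (_ * _).
set y := Lambda x _; set p := adjoint_sub _ _.
rewrite innerC (_ : inner f _ = inner (csval (orthproj (F x) f)) (csval p)).
  by rewrite -adjoint_subP // -innerC.
by apply/eqP; rewrite -subr_eq0 -innerBl orthprojP.
Qed.

(** The frame operator identity gives the integrals on the diagonal;
    polarising both sides gives the others. *)
Lemma integrable_Re_frame_form f g :
  mu.-integrable setT (fun x => (scalar_Re (frame_form f g x))%:E) /\
  \int[mu]_x scalar_Re (frame_form f g x) = rip (S f) g.
Proof.
pose q h x := scalar_Re (frame_form h h x).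
have qS h : mu.-integrable setT (EFin \o q h) /\ \int[mu]_x q h x = rip (S h) h.
  have [[int _] SE] := S_frameop h.
  split.
    by apply: eq_integrable int => // x _; rewrite /= frame_form_diag.
  rewrite /rip SE /scalar_integral scalar_Re_mk; apply: eq_Rintegral => x _.
  by rewrite frame_form_diag.
have [i1 e1] := qS f; have [i2 e2] := qS g; have [i3 e3] := qS (f + g).
have E x : scalar_Re (frame_form f g x) =
    2^-1 * (q (f + g) x - (q f x + q g x)).
  exact: frame_form_polar.
have i12 : mu.-integrable setT (EFin \o (fun x => q f x + q g x)).
  by apply: eq_integrable (integrableD measurableT i1 i2).
have i123 : mu.-integrable setT
    (EFin \o (fun x => q (f + g) x - (q f x + q g x))).
  by apply: eq_integrable (integrableB measurableT i3 i12).
split.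
  apply: eq_integrable (integrableZl measurableT 2^-1 i123) => // x _.
  by rewrite /= E.
under eq_Rintegral do rewrite E.
rewrite RintegralZl // RintegralB // RintegralD // e1 e2 e3.
rewrite raddfD !(ripDl, ripDr) (ripC (S g) f) {2}/rip -S_sym -/(rip _ _).
by field.
Qed.

(** The imaginary part of the form at [g] is its real part at [i g]. *)
Lemma frame_form_integral f g :
  scalar_integrable mu (frame_form f g) /\
  scalar_integral mu (frame_form f g) = inner (S f) g.
Proof.
have [re_int reE] := integrable_Re_frame_form f g.
have [im_int imE] := integrable_Re_frame_form f (im_unit R k *: g).
have E x : scalar_Im (frame_form f g x) =
    scalar_Re (frame_form f (im_unit R k *: g) x).
  by rewrite scalar_Im_Re frame_formZr.
split.
  by split=> //; apply: eq_integrable im_int => // x _; rewrite /= E.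
rewrite /scalar_integral reE; under eq_Rintegral do rewrite E.
by rewrite imE /rip innerZr -scalar_Im_Re mkscalarK.
Qed.

End FrameForm.

(** * Frame bounds as coercivity *)

Section Frames.
Context (R : realType) (k : scalar_kind) (H : hilbertType R k).
Implicit Types (T Q : H -> H).

Lemma selfadjoint_symmetric Q : selfadjoint_op Q -> symmetric_op Q.
Proof. by move=> sQ f g; rewrite /rip sQ. Qed.

Lemma positive_nonneg Q : positive_op Q -> nonneg_op Q.
Proof. by move=> [_ Q0] f; rewrite -(@scalar_Re0 R k); exact: scalar_Re_le. Qed.

Lemma selfadjoint_inner_real Q f :
  selfadjoint_op Q -> inner (Q f) f = real_scalar k (rip (Q f) f).
Proof. by move=> sQ; apply: real_scalar_conj; rewrite -innerC sQ. Qed.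

(** A self-adjoint operator has a real quadratic form, so scalar frame bounds
    amount to real ones; the upper one comes from boundedness.  The maximum
    below ensures that the upper constant is at least the lower one. *)
Lemma frame_boundsP Q : selfadjoint_op Q -> form_bounded Q ->
  (exists A B : scalars R k, [/\ 0 < A, A <= B &
    forall f, A * `|f| ^+ 2 <= inner (Q f) f <= B * `|f| ^+ 2]) <-> coercive Q.
Proof.
move=> sQ [c c0 Qc]; split=> [[A [B [A0 _ AB]]]|[a a0 Qa]].
  have AE := real_scalar_ge0 (ltW A0).
  exists (scalar_Re A) => [|f].
    by rewrite -(real_scalar_lt k) -AE rmorph0.
  have /andP[+ _] := AB f.
  rewrite AE rip_norm selfadjoint_inner_real // -rmorphM real_scalar_le.
  by rewrite scalar_Re_rs.
exists (real_scalar k a), (real_scalar k (Num.max a c)).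
split; first by rewrite -(rmorph0 (real_scalar k)) real_scalar_lt.
  by rewrite real_scalar_le le_max lexx.
move=> f.
rewrite rip_norm selfadjoint_inner_real // -!rmorphM !real_scalar_le Qa /=.
by apply: le_trans (Qc f) _; rewrite ler_wpM2r ?rip_ge0 // le_max lexx orbT.
Qed.

End Frames.

(** Polarisation turns the controlled integral into the quadratic form of [Q];
    this [Q] will be [T S U], and [S] itself when [T] and [U] are identities. *)
Lemma controlled_frameP (R : realType) (k : scalar_kind) (H : hilbertType R k)
    (d : measure_display) (X : measurableType d)
    (mu : {measure set X -> \bar R})
    (F : X -> closedSubspace H) (K : X -> hilbertType R k)
    (Lambda : forall x, {linear csub_of (F x) -> K x}) (v : X -> R)
    (S : {linear H -> H}) (T U Q : H -> H) :
  (forall x, bounded_sub (Lambda x)) ->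
  selfadjoint_op S -> gfusion_frame_operator mu Lambda v S ->
  (forall f, inner (S (U f)) (T f) = inner (Q f) f) ->
  selfadjoint_op Q -> form_bounded Q ->
  continuous_controlled_gfusion_frame mu Lambda v T U <->
  (forall f, borel_measurable (fun x => csval (orthproj (F x) f))) /\
  coercive Q.
Proof.
move=> Lb sS SF QE sQ Qb.
have int f := frame_form_integral Lb sS SF (U f) (T f).
split=> [[meas [A [B [A0 AB fr]]]]|[meas /(frame_boundsP sQ Qb)]].
  split=> //; apply/(frame_boundsP sQ Qb); exists A, B; split=> // f.
  by have [_] := fr f; have [_ ->] := int f; rewrite QE.
move=> [A [B [A0 AB fr]]]; split=> //; exists A, B; split=> // f h.
have [i e] := int f; split; first exact: i.
by rewrite [scalar_integral _ _]e QE; exact: fr.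
Qed.

Theorem theorem3p10 (R : realType) (k : scalar_kind) (H : hilbertType R k)
    (Hsep : separable_space H)
    (d : measure_display) (X : measurableType d)
    (mu : {measure set X -> \bar R})
    (F : X -> closedSubspace H) (K : X -> hilbertType R k)
    (Lambda : forall x : X, {linear csub_of (F x) -> K x})
    (Lambda_bounded : forall x : X, bounded_sub (Lambda x))
    (v : X -> R) (v_meas : measurable_fun setT v)
    (v_ge0 : forall x : X, 0 <= v x)
    (T U : {linear H -> H}) (T_GBp : GBplus T) (U_GBp : GBplus U)
    (S : {linear H -> H}) (S_bounded : bounded_op S) (S_pos : positive_op S)
    (S_frameop : gfusion_frame_operator mu Lambda v S)
    (ST_comm : commuting S T)
    (UT_comm : commuting U T) (US_comm : commuting U S) :
  continuous_controlled_gfusion_frame mu Lambda v T U <->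
  continuous_gfusion_frame mu Lambda v.
Proof.
case: T_GBp U_GBp => pT bT [T' [bT' TK T'K]] [pU bU [U' [bU' UK U'K]]].
case: (S_pos) (pT) (pU) => saS _ [saT _] [saU _].
have [sS sT sU] := And3 (selfadjoint_symmetric saS) (selfadjoint_symmetric saT)
  (selfadjoint_symmetric saU).
pose W : H -> H := U \o T; pose W' : H -> H := T' \o U'.
have sW : symmetric_op W by exact: symmetric_comp.
have WK : cancel W W' by move=> f; rewrite /W /W' /= UK TK.
have W'K : cancel W' W by move=> f; rewrite /W /W' /= T'K U'K.
have sW' : symmetric_op W' by exact: symmetric_inv sW W'K.
have WS : commuting W S by move=> f; rewrite /W /= -ST_comm US_comm.
have bW : norm_bounded W by apply: norm_bounded_comp; exact: bounded_opP.
have bW' : norm_bounded W' by apply: norm_bounded_comp; exact: bounded_opP.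
have bS := bounded_opP S_bounded.
have W0 : nonneg_op W.
  apply: nonneg_comp => //; try exact: positive_nonneg.
  exact/norm_bounded_form/bounded_opP.
have W'0 : nonneg_op W' by move=> f; rewrite -{2}(W'K f) ripC; exact: W0.
pose Q : H -> H := W \o S.
have saQ : selfadjoint_op Q.
  by move=> f g; rewrite /Q /W /= saU saT saS ST_comm -US_comm UT_comm.
have bQ : form_bounded Q by exact/norm_bounded_form/norm_bounded_comp.
have QE f : inner (S (U f)) (T f) = inner (Q f) f.
  by rewrite -saT /Q /W /= UT_comm US_comm.
rewrite /continuous_gfusion_frame.
rewrite (controlled_frameP Lambda_bounded saS S_frameop QE saQ bQ).
rewrite (controlled_frameP Lambda_bounded saS S_frameop (fun=> erefl) saS
           (norm_bounded_form bS)).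
split=> -[meas]; split=> //; last first.
  exact: (coercive_comp sW W0 (norm_bounded_form bW) WK W'K
            (norm_bounded_form bW') sS).
have sQ := selfadjoint_symmetric saQ.
have -> : (S : H -> H) = W' \o Q by apply: funext => f /=; rewrite /Q /= WK.
apply: (coercive_comp sW' W'0 (norm_bounded_form bW') W'K WK
            (norm_bounded_form bW) sQ) => //.
by move=> f; rewrite -[LHS]/(W (S (W' f))) WS W'K -[RHS]/(W' (W (S f))) WK.
Qed.
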